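(* Let $\alpha:I\to M$ be a null Cartan curve on a timelike hypersurface $M^3\subset\mathbb{E}^4_1$ with Darboux frame $\{T,\zeta,e,\eta\}$, let $W$ be a fixed vector written in the Darboux frame as $W=aT+b\zeta+ce+d\eta$, and let $\widetilde\eta=\eta+\lambda_1T+\lambda_2e$ be a generalized normal. Then $\alpha$ is a normal isophotic curve with axis $W$ if and only if $$\varepsilon_1b\,\lambda_1'+c\,\lambda_2'=\mathcal{R}[\lambda_1,\lambda_2],$$ where $$\mathcal{R}[\lambda_1,\lambda_2]=(\tau_nb+\kappa_na+\tau^*c)+\lambda_1(-\kappa_gb-\kappa_ec-\kappa_nd)+\lambda_2(\tau_eb+\kappa_ea-\tau^*d).$$
   Context: Minkowski space-time $\mathbb{E}^4_1$ is $\mathbb{R}^4$ with the metric $\langle x,y\rangle=-x_1y_1+x_2y_2+x_3y_3+x_4y_4$. A null Cartan curve is a smooth null curve on an interval $I$ ($\alpha'\neq0$, $\langle\alpha',\alpha'\rangle=0$) parametrized by pseudo-arc length $s$, i.e. $\langle\alpha'',\alpha''\rangle=1$; $T=\alpha'$, and primes denote $d/ds$. A timelike hypersurface $M^3\subset\mathbb{E}^4_1$ is one with spacelike unit normal $\eta$, $\langle\eta,\eta\rangle=1$. Along $\alpha\subset M$, a Darboux frame $\{T,\zeta,e,\eta\}$ has $\zeta,e$ tangent to $M$ and satisfies $\langle T,T\rangle=\langle\zeta,\zeta\rangle=0$, $\langle T,\zeta\rangle=\varepsilon_1=\pm1$, $\langle e,e\rangle=\langle\eta,\eta\rangle=1$,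 all other inner products zero. It satisfies $$T'=\varepsilon_1\kappa_gT+\kappa_ee+\kappa_n\eta,\quad \zeta'=-\varepsilon_1\kappa_g\zeta+\tau_ee+\tau_n\eta,$$ $$e'=-\varepsilon_1\tau_eT-\varepsilon_1\kappa_e\zeta+\tau^*\eta,\quad \eta'=-\varepsilon_1\tau_nT-\varepsilon_1\kappa_n\zeta-\tau^*e,$$ with six curvature functions $\kappa_g=\langle T',\zeta\rangle$, $\kappa_e=\langle T',e\rangle$, $\kappa_n=\langle T',\eta\rangle$, $\tau_e=\langle\zeta',e\rangle$, $\tau_n=\langle\zeta',\eta\rangle$, $\tau^*=\langle e',\eta\rangle$. The components $a,b,c,d$ of $W$ are functions of $s$. The generalized normal along $\alpha$ is $\widetilde\eta=\eta+\lambda_1(s)T+\lambda_2(s)e$ with smooth $\lambda_1,\lambda_2$; $\alpha$ is a normal isophotic curve with axis $W$ (for this $\widetilde\eta$) if $\langle\widetilde\eta,W\rangle=\bar c$ for some constant $\bar c\in\mathbb{R}$. *)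

(* Defs.v *)
From HB Require Import structures.
From mathcomp Require Import all_boot all_order all_algebra.
From mathcomp Require Import all_classical all_reals all_analysis.
Set Implicit Arguments.
Unset Strict Implicit.
Unset Printing Implicit Defensive.
Import Order.TTheory GRing.Theory Num.Theory.
Import numFieldNormedType.Exports.
Local Open Scope ring_scope.
Local Open Scope classical_set_scope.

(* The real line is an arbitrary [R : realType].
   Curves, frame fields and scalar functions along a curve are total functions
   on [R], but only their values and derivatives at points of the parameter
   interval [I] are ever used.  [I] may be any nondegenerate interval: at an
   endpoint belonging to [I], smoothness means that the function is given
   together with an extension past the endpoint, so that the two-sided
   derivative [f^`()] exists there and equals the one-sided one along [I]. *)

Definition nondegenerate_interval (R : realType) (I : set R) : Prop :=
  is_interval I /\ exists x y, [/\ I x, I y & x < y].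

(* Smooth at every point of [A]: all iterated directional derivatives (the
   function itself for [vs = [::]]) are Frechet differentiable there.  For
   [U = R], taking [vs = nseq n 1] gives the [n]-th derivative. *)
Definition smooth_on (R : realType) (U V : normedModType R)
    (A : set U) (f : U -> V) : Prop :=
  forall (vs : seq U) (x : U), A x ->
    differentiable (foldr (fun v g => 'D_v g) f vs) x.

(* The Lorentzian metric; the timelike coordinate x_1 has index 0. *)
Definition mink (R : realType) (x y : 'rV[R]_4) : R :=
  - (x 0 0 * y 0 0) + x 0 1 * y 0 1 + x 0 2 * y 0 2 + x 0 3 * y 0 3.

(* [f = 0] is a regular equation of [M] on the neighbourhood [U] of [p]. *)
Definition local_equation (R : realType) (M : set 'rV[R]_4) (p : 'rV[R]_4)
    (U : set 'rV[R]_4) (f : 'rV[R]_4 -> R) : Prop :=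
  [/\ open U, U p, smooth_on U f,
      forall q, U q -> (M q <-> f q = 0) &
      forall q, U q -> M q -> exists v, 'd f q v != 0].

Definition hypersurface (R : realType) (M : set 'rV[R]_4) : Prop :=
  forall p, M p -> exists U f, local_equation M p U f.

(* T_p M is the kernel of the differential of a local equation of [M] at [p];
   it does not depend on the equation. *)
Definition tangent_to (R : realType) (M : set 'rV[R]_4) (p v : 'rV[R]_4) : Prop :=
  exists U f, local_equation M p U f /\ 'd f p v = 0.

Definition normal_to (R : realType) (M : set 'rV[R]_4) (p n : 'rV[R]_4) : Prop :=
  forall v, tangent_to M p v -> mink n v = 0.

Definition timelike_hypersurface (R : realType) (M : set 'rV[R]_4) : Prop :=
  hypersurface M /\
  forall p, M p -> exists n, normal_to M p n /\ mink n n = 1.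

Definition null_cartan_curve (R : realType) (I : set R)
    (alpha : R -> 'rV[R]_4) : Prop :=
  smooth_on (V := 'rV[R]_4) I alpha /\
  forall s, I s ->
    [/\ derive1 alpha s != 0,
        mink (derive1 alpha s) (derive1 alpha s) = 0 &
        mink (derive1n 2 alpha s) (derive1n 2 alpha s) = 1].

Record frame (R : realType) := Frame {
  fr_T : R -> 'rV[R]_4;
  fr_zeta : R -> 'rV[R]_4;
  fr_e : R -> 'rV[R]_4;
  fr_eta : R -> 'rV[R]_4 }.

(* The structure equations of the frame are not part of the definition: they
   follow from the inner products below and the definitions of the curvature
   functions. *)
Definition darboux_frame (R : realType) (M : set 'rV[R]_4) (I : set R)
    (alpha : R -> 'rV[R]_4) (eps1 : R) (F : frame R) : Prop :=
  [/\ eps1 = 1 \/ eps1 = -1,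
      fr_T F = derive1 alpha,
      [/\ smooth_on (V := 'rV[R]_4) I (fr_zeta F),
          smooth_on (V := 'rV[R]_4) I (fr_e F) &
          smooth_on (V := 'rV[R]_4) I (fr_eta F)],
      forall s, I s ->
        [/\ tangent_to M (alpha s) (fr_zeta F s),
            tangent_to M (alpha s) (fr_e F s) &
            normal_to M (alpha s) (fr_eta F s)] &
      forall s, I s ->
        [/\ mink (fr_T F s) (fr_T F s) = 0 /\
              mink (fr_zeta F s) (fr_zeta F s) = 0,
            mink (fr_T F s) (fr_zeta F s) = eps1,
            mink (fr_e F s) (fr_e F s) = 1 /\
              mink (fr_eta F s) (fr_eta F s) = 1,
            mink (fr_T F s) (fr_e F s) = 0 /\
              mink (fr_T F s) (fr_eta F s) = 0 &
            [/\ mink (fr_zeta F s) (fr_e F s) = 0,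
                mink (fr_zeta F s) (fr_eta F s) = 0 &
                mink (fr_e F s) (fr_eta F s) = 0]]].

Section Curvatures.
Variables (R : realType) (F : frame R).

Definition kappa_g (s : R) : R := mink (derive1 (fr_T F) s) (fr_zeta F s).
Definition kappa_e (s : R) : R := mink (derive1 (fr_T F) s) (fr_e F s).
Definition kappa_n (s : R) : R := mink (derive1 (fr_T F) s) (fr_eta F s).
Definition tau_e (s : R) : R := mink (derive1 (fr_zeta F) s) (fr_e F s).
Definition tau_n (s : R) : R := mink (derive1 (fr_zeta F) s) (fr_eta F s).
Definition tau_star (s : R) : R := mink (derive1 (fr_e F) s) (fr_eta F s).

Definition generalized_normal (lambda1 lambda2 : R -> R) (s : R) : 'rV[R]_4 :=
  fr_eta F s + lambda1 s *: fr_T F s + lambda2 s *: fr_e F s.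

Definition normal_isophotic (I : set R) (lambda1 lambda2 : R -> R)
    (W : 'rV[R]_4) : Prop :=
  exists cbar : R, forall s, I s ->
    mink (generalized_normal lambda1 lambda2 s) W = cbar.

Definition calR (a b c d lambda1 lambda2 : R -> R) (s : R) : R :=
  (tau_n s * b s + kappa_n s * a s + tau_star s * c s)
  + lambda1 s * (- (kappa_g s * b s) - kappa_e s * c s - kappa_n s * d s)
  + lambda2 s * (tau_e s * b s + kappa_e s * a s - tau_star s * d s).

End Curvatures.

(* Main.v *)
Require Import Defs.
From HB Require Import structures.
From mathcomp Require Import all_boot all_order all_algebra.
From mathcomp Require Import all_classical all_reals all_analysis.
From mathcomp Require Import ring lra.
Import Order.TTheory GRing.Theory Num.Theory.
Import numFieldNormedType.Exports.
Local Open Scope ring_scope.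
Local Open Scope classical_set_scope.

Set Implicit Arguments.
Unset Strict Implicit.

(** Differentiate [mink eta~ W] along the curve.  Since [W] is constant, the
    product rule gives
    [mink eta' W + l1' * mink T W + l1 * mink T' W + l2' * mink e W
     + l2 * mink e' W], where [l1], [l2] are the coefficients of the generalized
    normal.  In the Darboux frame, [mink T W = eps1 * b] and [mink e W = c], and
    [mink T' W], [mink e' W], [mink eta' W] are linear in the components
    [a, b, c, d] with coefficients the curvature functions; those of
    [mink e' W] and [mink eta' W] come from differentiating the constant inner
    products of the frame ([mink_derive_antisym]).  The derivative is then the
    difference of the two sides of the equation
    ([is_derive_mink_generalized_normal]).

    It remains to pass between a function on [I] being constant and its
    derivative being zero there ([constant_on_intervalP]).  As derivatives are
    two-sided while the inner products are controlled on [I] only, a point of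
    [I] that is an endpoint has to be treated through points of [I] lying
    on one side of it ([is_derive_constant_on]). *)

(** * Functions with zero derivative on an interval *)

Section ConstantOnInterval.
Context {R : realType}.
Implicit Types (I : set R) (f : R -> R) (s l : R).

(** The difference quotient of [f] at [s] vanishes at the points of the segment
    from [s] to any other point [t] of [I], and these accumulate at [s]; so its
    limit is zero even when [I] lies on one side of [s]. *)
Lemma is_derive_constant_on I f s l k :
  nondegenerate_interval I -> I s -> (forall t, I t -> f t = k) ->
  is_derive s 1 f l -> l = 0.
Proof.
move=> [itvI [x [y [Ix Iy xy]]]] Is fk /is_derive1_caratheodory[h [fE hc <-]].
have [t It ts] : exists2 t, I t & t != s.
  have [xs|] := eqVneq x s; last by exists x.
  by exists y => //; rewrite -xs gt_eqF.
have Iseg u : 0 <= u <= 1 -> I (s + u * (t - s)).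
  move=> /andP[u0 u1]; have [ts'|st] := leP t s.
    by apply: (itvI t s It Is); apply/andP; split; nra.
  by apply: (itvI s t Is It); apply/andP; split; nra.
(* [h] is the difference quotient of [f] at [s], extended by its limit. *)
have h0 u : 0 < u <= 1 -> h (s + u * (t - s)) = 0.
  move=> /andP[u0 u1].
  have := fE (s + u * (t - s)).
  rewrite !fk //; last by apply: Iseg; rewrite ltW.
  rewrite subrr addrAC subrr add0r => /esym/eqP.
  by rewrite !mulf_eq0 subr_eq0 (negbTE ts) (gt_eqF u0) !orbF => /eqP.
have cseg : h (s + u * (t - s)) @[u --> 0^'+] --> h s.
  apply: cvg_at_right_filter.
  have seg_s : s + u * (t - s) @[u --> (0 : R)] --> s.
    rewrite -[X in _ --> X]addr0 -[X in s + X](mul0r (t - s)).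
    by apply: cvgD; [exact: cvg_cst|apply: cvgMl; exact: cvg_id].
  exact: cvg_comp seg_s hc.
rewrite -(cvg_lim _ cseg)//; apply: lim_near_cst => //.
near=> u; apply: h0; apply/andP; split; near: u.
  exact: nbhs_right_gt.
by apply: nbhs_right_le.
Unshelve. all: by end_near. Qed.

Lemma is_derive_0_constant_on I f :
  is_interval I -> (forall s, I s -> is_derive s 1 f 0) ->
  forall s t, I s -> I t -> f s = f t.
Proof.
move=> itvI df.
suff H s t : s <= t -> I s -> I t -> f s = f t.
  by move=> s t Is It; case: (leP s t) => [/H|/ltW/H fE]; [exact|rewrite fE].
move=> st Is It.
have Iu u : u \in `[s, t]%R -> I u by rewrite inE /= => /(itvI s t Is It).
have [u /andP[su ut]||_ _] := @MVT_segment R f (fun=> 0) s t st.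
- by apply/df/(itvI s t Is It); rewrite (ltW su) (ltW ut).
- by apply: derivable_within_continuous => u /Iu Iu'; case: (df u Iu').
- by rewrite mul0r => /eqP; rewrite subr_eq0 => /eqP.
Qed.

Lemma constant_on_intervalP I f df :
  nondegenerate_interval I -> (forall s, I s -> is_derive s 1 f (df s)) ->
  (exists k, forall s, I s -> f s = k) <-> (forall s, I s -> df s = 0).
Proof.
move=> nI fdf; split=> [[k fk] s Is|df0].
  exact: is_derive_constant_on nI Is fk (fdf s Is).
case: (nI) => itvI [x [_ [Ix _ _]]]; exists (f x) => s Is.
apply: is_derive_0_constant_on itvI _ _ _ Is Ix => t It.
by rewrite -(df0 t It); exact: fdf.
Qed.

End ConstantOnInterval.

(** * Differentiating inner products along a curve *)

Section Mink.
Context {R : realType}.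
Implicit Types (u v w : 'rV[R]_4) (I : set R).

Lemma minkC u v : mink u v = mink v u.
Proof. by rewrite /mink; ring. Qed.

Lemma minkDl u v w : mink (u + v) w = mink u w + mink v w.
Proof. by rewrite /mink !mxE; ring. Qed.

Lemma minkZl (k : R) u v : mink (k *: u) v = k * mink u v.
Proof. by rewrite /mink !mxE; ring. Qed.

Lemma minkDr u v w : mink u (v + w) = mink u v + mink u w.
Proof. by rewrite !(minkC u) minkDl. Qed.

Lemma minkZr (k : R) u v : mink u (k *: v) = k * mink u v.
Proof. by rewrite !(minkC u) minkZl. Qed.

Lemma mink0r u : mink u 0 = 0.
Proof. by rewrite -(scale0r u) minkZr mul0r. Qed.

Lemma is_derive_coord (f : R -> 'rV[R]_4) (s : R) (i : 'I_4) :
  derivable f s 1 -> is_derive s 1 (fun t => f t 0 i) (derive1 f s 0 i).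
Proof.
move=> df; rewrite derive1E derive_mx // mxE.
by apply: derivableP; move/derivable_mxP: df; exact.
Qed.

Lemma is_derive_mink (f g : R -> 'rV[R]_4) (s : R) :
  derivable f s 1 -> derivable g s 1 ->
  is_derive s 1 (fun t => mink (f t) (g t))
    (mink (derive1 f s) (g s) + mink (f s) (derive1 g s)).
Proof.
move=> df dg.
have fE i := is_derive_coord i df.
have gE i := is_derive_coord i dg.
have fgE i := is_deriveM (fE i) (gE i).
apply: is_derive_eq (is_deriveD (is_deriveD (is_deriveD
  (is_deriveN (fgE 0)) (fgE 1)) (fgE 2)) (fgE 3)) _.
rewrite /mink /GRing.scale /=; ring.
Qed.

Lemma mink_derive_antisym I (f g : R -> 'rV[R]_4) (s k : R) :
  nondegenerate_interval I -> I s -> (forall t, I t -> mink (f t) (g t) = k) ->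
  derivable f s 1 -> derivable g s 1 ->
  mink (derive1 g s) (f s) = - mink (derive1 f s) (g s).
Proof.
move=> nI Is fgk df dg; apply/eqP; rewrite -addr_eq0 addrC (minkC _ (f s)).
by apply/eqP; exact: is_derive_constant_on nI Is fgk (is_derive_mink df dg).
Qed.

Lemma is_derive_mink_cst (f : R -> 'rV[R]_4) (s : R) w :
  derivable f s 1 -> is_derive s 1 (fun t => mink (f t) w) (mink (derive1 f s) w).
Proof.
move=> df.
have dw : derivable (cst w : R -> 'rV[R]_4) s 1 by exact: derivable_cst.
apply: is_derive_eq (is_derive_mink df dw) _.
by rewrite derive1_cst mink0r addr0.
Qed.

(** These are the cases of no direction and of the single direction [1] in the
    definition of smoothness. *)
Lemma smooth_on_derivable {V : normedModType R} I (f : R -> V) s :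
  smooth_on I f -> I s -> derivable f s 1 /\ derivable (derive1 f) s 1.
Proof.
move=> sf Is; split; apply: diff_derivable; first exact: (sf [::]).
have -> : derive1 f = 'D_1 f by apply/funext => t; rewrite derive1E.
exact: (sf [:: 1]).
Qed.

End Mink.

(** * The derivative of the angle function *)

Section Frame.
Variables (R : realType) (M : set 'rV[R]_4) (I : set R) (alpha : R -> 'rV[R]_4).
Variables (eps1 : R) (F : frame R) (W : 'rV[R]_4) (a b c d : R -> R).
Hypothesis nI : nondegenerate_interval I.
Hypothesis curve : null_cartan_curve I alpha.
Hypothesis dF : darboux_frame M I alpha eps1 F.
Hypothesis WE : forall s, I s ->
  W = a s *: fr_T F s + b s *: fr_zeta F s + c s *: fr_e F s + d s *: fr_eta F s.

Local Lemma derivable_frame s : I s ->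
  [/\ derivable (fr_T F) s 1, derivable (fr_zeta F) s 1,
      derivable (fr_e F) s 1 & derivable (fr_eta F) s 1].
Proof.
move=> Is; case: dF => _ TE [sz se sn] _ _; rewrite TE; split.
- exact: proj2 (smooth_on_derivable (V := 'rV[R]_4) curve.1 Is).
- exact: proj1 (smooth_on_derivable (V := 'rV[R]_4) sz Is).
- exact: proj1 (smooth_on_derivable (V := 'rV[R]_4) se Is).
- exact: proj1 (smooth_on_derivable (V := 'rV[R]_4) sn Is).
Qed.

Lemma mink_frame_axis s : I s ->
  mink (fr_T F s) W = eps1 * b s /\ mink (fr_e F s) W = c s.
Proof.
move=> Is; case: dF => _ _ _ _ /(_ s Is).
move=> [[TT _] Tz [ee _] [Te Tn] [ze _ en]].
rewrite (WE Is) !minkDr !minkZr TT Tz Te Tn (minkC (fr_e F s) (fr_T F s)).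
rewrite (minkC (fr_e F s) (fr_zeta F s)) Te ze ee en.
by split; ring.
Qed.

(** The structure equations paired with [W].  Expanding [W], rather than
    [T'], [e'] and [eta'], in the frame avoids having to show that the frame
    spans the space. *)
Lemma mink_derive_frame_axis s : I s ->
  [/\ mink (derive1 (fr_T F) s) W
       = kappa_g F s * b s + kappa_e F s * c s + kappa_n F s * d s,
      mink (derive1 (fr_e F) s) W
       = - (kappa_e F s * a s) - tau_e F s * b s + tau_star F s * d s &
      mink (derive1 (fr_eta F) s) W
       = - (kappa_n F s * a s) - tau_n F s * b s - tau_star F s * c s].
Proof.
move=> Is; have [dT dz de dn] := derivable_frame Is.
case: dF => _ _ _ _ ortho.
(* A unit or null field is orthogonal to its derivative: its self-product
   is constant, and the antisymmetry then reads x = - x. *)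
have self f k : derivable f s 1 -> (forall t, I t -> mink (f t) (f t) = k) ->
    mink (derive1 f s) (f s) = 0.
  by move=> df fk; have := mink_derive_antisym nI Is fk df df; lra.
have TT : mink (derive1 (fr_T F) s) (fr_T F s) = 0.
  by apply: (self _ 0) => // t /ortho[[]].
have ee : mink (derive1 (fr_e F) s) (fr_e F s) = 0.
  by apply: (self _ 1) => // t /ortho[_ _ []].
have nn : mink (derive1 (fr_eta F) s) (fr_eta F s) = 0.
  by apply: (self _ 1) => // t /ortho[_ _ []].
have anti f g : derivable f s 1 -> derivable g s 1 ->
    (forall t, I t -> mink (f t) (g t) = 0) ->
    mink (derive1 g s) (f s) = - mink (derive1 f s) (g s).
  by move=> df dg fg0; exact: mink_derive_antisym nI Is fg0 df dg.
have eT : mink (derive1 (fr_e F) s) (fr_T F s) = - kappa_e F s.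
  by apply: (anti _ _ dT de) => t /ortho[_ _ _ []].
have nT : mink (derive1 (fr_eta F) s) (fr_T F s) = - kappa_n F s.
  by apply: (anti _ _ dT dn) => t /ortho[_ _ _ []].
have ez : mink (derive1 (fr_e F) s) (fr_zeta F s) = - tau_e F s.
  by apply: (anti _ _ dz de) => t /ortho[_ _ _ _ []].
have nz : mink (derive1 (fr_eta F) s) (fr_zeta F s) = - tau_n F s.
  by apply: (anti _ _ dz dn) => t /ortho[_ _ _ _ []].
have ne : mink (derive1 (fr_eta F) s) (fr_e F s) = - tau_star F s.
  by apply: (anti _ _ de dn) => t /ortho[_ _ _ _ []].
have mW u : mink u W = a s * mink u (fr_T F s) + b s * mink u (fr_zeta F s)
    + c s * mink u (fr_e F s) + d s * mink u (fr_eta F s).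
  by rewrite (WE Is) !minkDr !minkZr.
split; rewrite mW.
- by rewrite TT /kappa_g /kappa_e /kappa_n; ring.
- by rewrite eT ez ee /tau_star; ring.
- by rewrite nT nz ne nn; ring.
Qed.

Lemma is_derive_mink_generalized_normal (l1 l2 : R -> R) s :
  I s -> derivable l1 s 1 -> derivable l2 s 1 ->
  is_derive s 1 (fun t => mink (generalized_normal F l1 l2 t) W)
    (eps1 * b s * derive1 l1 s + c s * derive1 l2 s
     - calR F a b c d l1 l2 s).
Proof.
move=> Is /derivableP dl1 /derivableP dl2.
have [dT _ de dn] := derivable_frame Is.
have [TW eW] := mink_frame_axis Is.
have [T'W e'W n'W] := mink_derive_frame_axis Is.
have -> : (fun t => mink (generalized_normal F l1 l2 t) W)
  = (fun t => mink (fr_eta F t) W)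
    + l1 * (fun t => mink (fr_T F t) W) + l2 * (fun t => mink (fr_e F t) W).
  by apply/funext => t; rewrite /generalized_normal !minkDl !minkZl.
apply: is_derive_eq (is_deriveD (is_deriveD (is_derive_mink_cst W dn)
  (is_deriveM dl1 (is_derive_mink_cst W dT)))
  (is_deriveM dl2 (is_derive_mink_cst W de))) _.
rewrite T'W e'W n'W TW eW -!derive1E /calR /GRing.scale /=; ring.
Qed.

End Frame.

Unset Implicit Arguments.
Set Strict Implicit.

Theorem theorem16 (R : realType) (I : set R) (M : set 'rV[R]_4)
  (alpha : R -> 'rV[R]_4) (eps1 : R) (F : frame R) (W : 'rV[R]_4)
  (a b c d lambda1 lambda2 : R -> R)
  (hI : nondegenerate_interval I)
  (hM : timelike_hypersurface M)
  (halpha : null_cartan_curve I alpha)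
  (halphaM : forall s, I s -> M (alpha s))
  (hF : darboux_frame M I alpha eps1 F)
  (hW : forall s, I s ->
     W = a s *: fr_T F s + b s *: fr_zeta F s + c s *: fr_e F s + d s *: fr_eta F s)
  (hlambda1 : smooth_on I lambda1)
  (hlambda2 : smooth_on I lambda2) :
  normal_isophotic F I lambda1 lambda2 W <->
  (forall s, I s ->
     eps1 * b s * derive1 lambda1 s + c s * derive1 lambda2 s
     = calR F a b c d lambda1 lambda2 s).
Proof.
have dg s (Is : I s) := is_derive_mink_generalized_normal hI halpha hF hW Is
  (smooth_on_derivable hlambda1 Is).1 (smooth_on_derivable hlambda2 Is).1.
apply: (iff_trans (constant_on_intervalP hI dg)).
by split=> eqR s Is; apply/eqP; move/eqP: (eqR s Is); rewrite subr_eq0.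
Qed.
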